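(* Let $\lambda,\mu>0$ with $\lambda\ne1$ be fixed (not depending on $n$). Put $$H(\lambda,\mu):=\mu\lambda\ln\lambda-(1+\mu\lambda)\ln\left(\frac{1+\mu\lambda}{1+\mu}\right),\qquad G(\lambda):=\lambda-1-\ln\lambda .$$ (Geometric) Let $X_1,X_2,\dots$ be i.i.d. geometric random variables (failure model) with mean $\mu$, and let $\bar X_n=(X_1+\cdots+X_n)/n$. Then $$\lim_{n\to\infty}\frac{-\ln\Pr[\bar X_n\ge\lambda\mu]}{n\,H(\lambda,\mu)}=1\quad\text{if }\lambda\in(1,\infty),\qquad \lim_{n\to\infty}\frac{-\ln\Pr[\bar X_n\le\lambda\mu]}{n\,H(\lambda,\mu)}=1\quad\text{if }\lambda\in(0,1).$$ (Exponential) Let $Y_1,Y_2,\dots$ be i.i.d. exponential random variables with mean $\mu$, and let $\bar Y_n=(Y_1+\cdots+Y_n)/n$. Then $$\lim_{n\to\infty}\frac{-\ln\Pr[\bar Y_n\ge\lambda\mu]}{n\,G(\lambda)}=1\quad\text{if }\lambda\in(1,\infty),\qquad \lim_{n\to\infty}\frac{-\ln\Pr[\bar Y_n\le\lambda\mu]}{n\,G(\lambda)}=1\quad\text{if }\lambda\in(0,1).$$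
   Context: A geometric random variable (failure model) with parameter $p\in(0,1)$ satisfies $\Pr[X=k]=p(1-p)^k$ for $k=0,1,2,\dots$; its mean is $\mu=(1-p)/p$, i.e. $p=1/(1+\mu)$. An exponential random variable with rate $\rho>0$ has density $\rho e^{-\rho y}$ on $[0,\infty)$; its mean is $\mu=1/\rho$. $\ln$ is the natural logarithm. *)

(* Defs.v *)
From HB Require Import structures.
From mathcomp Require Import all_boot all_order all_algebra.
From mathcomp Require Import finmap.
From mathcomp Require Import all_classical all_reals all_analysis.

Set Implicit Arguments.
Unset Strict Implicit.
Unset Printing Implicit Defensive.

Import Order.TTheory GRing.Theory Num.Theory.
Import numFieldNormedType.Exports.

Local Open Scope classical_set_scope.
Local Open Scope ring_scope.

Section rates.
Context {R : realType}.

Definition geometric_rate (lambda mu : R) : R :=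
  mu * lambda * ln lambda
  - (1 + mu * lambda) * ln ((1 + mu * lambda) / (1 + mu)).

Definition exponential_rate (lambda : R) : R := lambda - 1 - ln lambda.

End rates.

Section random_variables.
Context {d : measure_display} {T : measurableType d} {R : realType}.
Variable P : probability T R.

(* Mutual independence: the product rule over every finite subfamily. *)
Definition independent_RVs (X : nat -> {RV P >-> R}) : Prop :=
  forall (J : {fset nat}) (A : nat -> set R),
    (forall i, measurable (A i)) ->
    P (\bigcap_(i in [set` J]) X i @^-1` A i) =
    (\prod_(i <- J) P (X i @^-1` A i))%E.

Definition identically_distributed (X : nat -> {RV P >-> R}) : Prop :=
  forall (i j : nat) (A : set R), measurable A ->
    distribution P (X i) A = distribution P (X j) A.

Definition iid (X : nat -> {RV P >-> R}) : Prop :=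
  independent_RVs X /\ identically_distributed X.

(* The failure model.  The masses sum to 1, so the real-valued variable X is
   almost surely a natural number. *)
Definition geometric_RV (p : R) (X : {RV P >-> R}) : Prop :=
  forall k : nat, P [set w | X w = k%:R] = (p * (1 - p) ^+ k)%:E.

Definition exponential_RV (rho : R) (X : {RV P >-> R}) : Prop :=
  forall A : set R, measurable A -> distribution P X A = exponential_prob rho A.

Definition geometric_with_mean (mu : R) (X : {RV P >-> R}) : Prop :=
  exists p : R, [/\ 0 < p < 1, geometric_RV p X & ('E_P[X] = mu%:E)%E].

Definition exponential_with_mean (mu : R) (X : {RV P >-> R}) : Prop :=
  exists rho : R, [/\ 0 < rho, exponential_RV rho X & ('E_P[X] = mu%:E)%E].

(* X is indexed from 0, so this is the mean of the first n variables (and 0 for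
   n = 0). *)
Definition sample_mean (X : nat -> {RV P >-> R}) (n : nat) (w : T) : R :=
  (\sum_(i < n) X i w) / n%:R.

End random_variables.

(* Main.v *)
Require Import Defs.
From HB Require Import structures.
From mathcomp Require Import all_boot all_order all_algebra.
From mathcomp Require Import all_classical all_reals all_analysis.
From mathcomp Require Import finmap measurable_realfun ring lra.

Import Order.TTheory GRing.Theory Num.Theory.
Import numFieldNormedType.Exports.

Local Open Scope classical_set_scope.
Local Open Scope ring_scope.

(** Both laws are handled by one argument about counts. Cut the line into
disjoint cells C 0, C 1, ... such that X_i lies in C k with probability
p (1 - p) ^ k. For a geometric variable C k is the singleton {k}; for an
exponential one the cells are consecutive intervals of a small length delta,
because the integer part of an exponential variable is geometric. If K_i is
the index of the cell that contains X_i, then K_1 + ... + K_N is negative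
binomial: by independence and stars and bars it equals m with probability
'C(N - 1 + m, m) p ^ N (1 - p) ^ m ([level_prob]).

Let rate p a be the Cramer rate of the geometric law of parameter p at a.

Upper bound ([negbin_tail_le]). Comparing the weights p ^ N (1 - p) ^ m with
those of the parameter 1 / (1 + a), whose mean is a, costs exactly a factor
exp (- N rate p a) when m = N a, and not more than that on the side of N a
away from the mean of p. Since the tilted weights have total mass at most 1
([sum_negative_binomial_le1]), the tail has probability at most
exp (- N rate p a). This is the Chernoff bound, without any integral.

Lower bound ([negbin_tail_ge]). The tail contains the event that the sum of
the K_i is some m within distance 1 of N a. For the binomial law on N + m
trials with success probability N / (N + m), the outcome N is the most likely
one ([bin_max_term]), so that its probability is at least 1 / (N + m + 1).
Therefore the event for m has probability at least exp (- N rate p (m / N))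
up to a factor polynomial in N, and rate p is continuous.

A geometric law needs no approximation, and rate p (lambda mu) is then the
rate H of the statement. For an exponential law, passing from X_i to
delta K_i changes the threshold by at most delta; the two thresholds
lambda mu / delta and lambda mu / delta - 1 have rates that differ from G by
O(delta) ([negbin_rate_exponential], [negbin_rate_exponential_pred]), and
delta is arbitrary.

The hypotheses give the mean and not the parameter. Summing over the cells
gives delta q / p <= mu <= delta q / p + delta with q = 1 - p
([mesh_mean_bounds]), and this determines the parameter in both cases. *)

(** * The largest binomial term *)

Lemma fact_le_mul_expn (b j i : nat) :
  (j + i <= b)%N -> ((j + i)`! <= j`! * b ^ i)%N.
Proof.
elim: i => [|i IH]; first by rewrite addn0 expn0 muln1.
rewrite addnS => lt_b; rewrite factS expnS mulnCA leq_mul//.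
by apply: IH; apply: ltnW.
Qed.

Lemma fact_mul_expn_le_fact (b i : nat) : (b`! * b ^ i <= (b + i)`!)%N.
Proof.
elim: i => [|i IH]; first by rewrite addn0 expn0 muln1.
by rewrite addnS factS expnS mulnCA leq_mul// -addnS leq_addr.
Qed.

(** The maximum of k ^ j / j`! over j is at j = k: passing from j to j + 1
multiplies this quotient by k / (j + 1). *)
Lemma fact_mul_expn_le (k j : nat) : (k`! * k ^ j <= j`! * k ^ k)%N.
Proof.
have [le_jk | /ltnW le_kj] := leqP j k.
- rewrite -{4}(subnK le_jk) expnD mulnA leq_mul2r; apply/orP; right.
  rewrite -{1}(subnKC le_jk); apply: fact_le_mul_expn.
  by rewrite subnKC.
- rewrite -{1}(subnK le_kj) expnD mulnA leq_mul2r; apply/orP; right.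
  by rewrite -{2}(subnKC le_kj) fact_mul_expn_le_fact.
Qed.

(** Up to the common factor (a + b)`!, each side is a product of two quotients
of the form x ^ j / j`!, and [fact_mul_expn_le] bounds both. *)
Lemma bin_mode_le (a b j : nat) : (j <= a + b)%N ->
  ('C(a + b, j) * (a ^ j * b ^ (a + b - j))
    <= 'C(a + b, a) * (a ^ a * b ^ b))%N.
Proof.
move=> le_j.
have facts_gt0 : (0 < a`! * b`! * (j`! * (a + b - j)`!))%N.
  by rewrite !muln_gt0 !fact_gt0.
rewrite -(leq_pmul2l facts_gt0).
have Ej := bin_fact le_j.
have Ea := bin_fact (leq_addr b a); rewrite addKn in Ea.
pose x := (a`! * a ^ j)%N; pose y := (b`! * b ^ (a + b - j))%N.
have -> : (a`! * b`! * (j`! * (a + b - j)`!)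
   * ('C(a + b, j) * (a ^ j * b ^ (a + b - j))) = (a + b)`! * (x * y))%N.
  by rewrite -Ej /x /y; ring.
have -> : (a`! * b`! * (j`! * (a + b - j)`!)
   * ('C(a + b, a) * (a ^ a * b ^ b)) =
   (a + b)`! * ((j`! * a ^ a) * ((a + b - j)`! * b ^ b)))%N.
  by rewrite -Ea; ring.
by rewrite leq_mul// leq_mul// fact_mul_expn_le.
Qed.

(** The left side is the sum of the a + b + 1 terms of the expansion of
(a + b) ^ (a + b), and the term of index a is the largest. *)
Lemma bin_max_term (a b : nat) :
  ((a + b) ^ (a + b) <= (a + b).+1 * ('C(a + b, a) * (a ^ a * b ^ b)))%N.
Proof.
rewrite {1}addnC expnDn -[X in (X * _)%N]card_ord -sum_nat_const.
apply: leq_sum => j _; rewrite [X in (_ * X)%N]mulnC.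
by apply: bin_mode_le; rewrite -ltnS.
Qed.

(** * Total mass of the negative binomial law *)

(** By Pascal's rule the partial sum s_(n+1) satisfies
s_(n+1) <= (1 - q) s_n + q s_(n+1), so that s_(n+1) <= s_n unless q = 1. *)
Lemma sum_negative_binomial_le1 {R : realFieldType} (q : R) (n M : nat) :
  0 <= q <= 1 ->
  \sum_(m < M) 'C(n + m, n)%:R * ((1 - q) ^+ n.+1 * q ^+ m) <= 1.
Proof.
move=> /andP[q0 q1]; have p0 : 0 <= 1 - q by lra.
have term_ge0 k m : 0 <= 'C(k + m, k)%:R * ((1 - q) ^+ k.+1 * q ^+ m).
  by rewrite !mulr_ge0// exprn_ge0.
elim: n M => [|n IH] M.
  under eq_bigr do rewrite bin0 mul1r expr1.
  rewrite -mulr_sumr -opprB mulNr -subrX1 opprB.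
  by rewrite lerBlDr lerDl exprn_ge0.
pose s k := \sum_(m < M) 'C(k + m, k)%:R * ((1 - q) ^+ k.+1 * q ^+ m).
rewrite -/(s n.+1).
have shift_le : \sum_(m < M) 'C(n + m, n.+1)%:R * ((1 - q) ^+ n.+2 * q ^+ m)
    <= q * s n.+1.
  rewrite /s; case: M {s} => [|M]; first by rewrite !big_ord0 mulr0.
  rewrite big_ord_recl addn0 bin_small// mul0r add0r.
  rewrite big_ord_recr mulrDr mulr_sumr.
  rewrite ler_wpDr ?(mulr_ge0 q0 (term_ge0 _ _))//.
  apply: ler_sum => m _; rewrite lift0 addnS addSn.
  rewrite -[nat_of_ord (widen_ord _ _)]/(nat_of_ord m) (exprS q).
  by rewrite [X in _ * X <= _]mulrCA [leLHS]mulrCA.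
have sE : s n.+1 = (1 - q) * s n +
    \sum_(m < M) 'C(n + m, n.+1)%:R * ((1 - q) ^+ n.+2 * q ^+ m).
  rewrite /s mulr_sumr -big_split; apply: eq_bigr => m _ /=.
  rewrite addSn binS natrD mulrDl addrC; congr (_ + _).
  by rewrite [in LHS]exprS -mulrA mulrCA.
have s_le : s n.+1 <= (1 - q) * 1 + q * s n.+1.
  by rewrite {1}sE lerD// ler_wpM2l// IH.
have [q_eq1|q_neq1] := eqVneq q 1.
  rewrite /s q_eq1 subrr big1 ?ler01// => m _.
  by rewrite [0 ^+ _]exprS !mul0r mulr0.
have p_gt0 : 0 < 1 - q by rewrite subr_gt0 lt_neqAle q_neq1.
by rewrite -(ler_pM2l p_gt0); lra.
Qed.

(** * The rate function of the geometric law *)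

Section Rate.
Context {R : realType}.
Implicit Types a p x : R.

(** This is (1 + a) times the relative entropy of the Bernoulli law of parameter
1 / (1 + a) with respect to the Bernoulli law of parameter p. *)
Definition negbin_rate p a : R :=
  a * ln (a / ((1 + a) * (1 - p))) - ln ((1 + a) * p).

Lemma negbin_rateE p a : 0 < p < 1 -> 0 < a ->
  negbin_rate p a = a * (ln a - ln (1 + a) - ln (1 - p)) - ln (1 + a) - ln p.
Proof.
move=> /andP[p0 p1] a0; have b0 : 0 < 1 + a by lra.
have q0 : 0 < 1 - p by lra.
rewrite /negbin_rate ln_div ?posrE ?mulr_gt0// !lnM ?posrE//; ring.
Qed.

Lemma exprn_expR x n : 0 < x -> x ^+ n = expR (n%:R * ln x).
Proof. by move=> x0; rewrite expRM_natl lnK. Qed.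

(** The quotient of the two weights is exp (- N rate) (q / q') ^ (m - N a), with
q = 1 - p and q' = a / (1 + a). By hypothesis m - N a and
ln (q' / q) do not have opposite signs, so that the last factor is at most 1. *)
Lemma negbin_term_tilt p a (N m : nat) : 0 < p < 1 -> 0 < a ->
  (m%:R - N%:R * a) * ln (a / ((1 + a) * (1 - p))) >= 0 ->
  p ^+ N * (1 - p) ^+ m <= expR (- (N%:R * negbin_rate p a)) *
    ((1 - a / (1 + a)) ^+ N * (a / (1 + a)) ^+ m).
Proof.
move=> p01 a0; have /andP[p0 p1] := p01; have b0 : 0 < 1 + a by lra.
have q0 : 0 < 1 - p by lra.
have -> : 1 - a / (1 + a) = (1 + a)^-1 by field; lra.
have ab0 : 0 < a / (1 + a) by rewrite divr_gt0.
have ib0 : 0 < (1 + a)^-1 by rewrite invr_gt0.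
rewrite !exprn_expR// -!expRD ler_expR negbin_rateE//.
rewrite !ln_div ?posrE ?mulr_gt0// lnM ?posrE// lnV ?posrE//.
nra.
Qed.

(** With N = n + 1 and a = m / N, the exponential is exactly the quotient of
p ^ N (1 - p) ^ m by the largest value that this weight takes as p varies;
[bin_max_term] compares that value with the binomial coefficient. *)
Lemma negbin_term_ge p (n m : nat) : 0 < p < 1 -> (0 < m)%N ->
  expR (- (n.+1%:R * negbin_rate p (m%:R / n.+1%:R))) *
    (n.+1%:R / ((n.+1 + m)%:R * (n.+1 + m).+1%:R))
  <= 'C(n + m, n)%:R * (p ^+ n.+1 * (1 - p) ^+ m).
Proof.
move=> p01 m0; have /andP[p0 p1] := p01; have q0 : 0 < 1 - p by lra.
set N := n.+1; set S := (N + m)%N.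
have N0 : 0 < N%:R :> R by rewrite ltr0n.
have m0' : 0 < m%:R :> R by rewrite ltr0n.
have S0 : 0 < S%:R :> R by rewrite ltr0n.
have T0 : 0 < S.+1%:R :> R by rewrite ltr0n.
have binE : N%:R * 'C(S, N)%:R = S%:R * 'C(n + m, n)%:R :> R.
  by rewrite -!natrM /S /N addSn mul_bin_diag.
have max_term : S%:R ^+ N * S%:R ^+ m <=
    S.+1%:R * ('C(S, N)%:R * (N%:R ^+ N * m%:R ^+ m)) :> R.
  by rewrite -exprD -!natrX -!natrM ler_nat bin_max_term.
have -> : expR (- (N%:R * negbin_rate p (m%:R / N%:R))) =
    S%:R ^+ N * S%:R ^+ m / (N%:R ^+ N * m%:R ^+ m) * (p ^+ N * (1 - p) ^+ m).
  rewrite negbin_rateE ?divr_gt0//.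
  have -> : 1 + m%:R / N%:R = S%:R / N%:R :> R.
    by rewrite /S natrD; field; lra.
  rewrite !exprn_expR// -!expRD -expRN -!expRD !ln_div ?posrE//.
  by congr expR; rewrite /S natrD; field; lra.
have D0 : 0 < N%:R ^+ N * m%:R ^+ m :> R by rewrite mulr_gt0// exprn_gt0.
rewrite mulrAC ler_wpM2r//.
  by rewrite mulr_ge0// exprn_ge0// ltW.
rewrite -(ler_pM2l S0) -binE.
have -> : S%:R * (S%:R ^+ N * S%:R ^+ m / (N%:R ^+ N * m%:R ^+ m) *
   (N%:R / (S%:R * S.+1%:R))) =
   N%:R * (S%:R ^+ N * S%:R ^+ m / S.+1%:R / (N%:R ^+ N * m%:R ^+ m)) :> R.
  by field; rewrite !expf_neq0 ?gt_eqF//= ltr_wpDr// ltW.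
rewrite ler_pM2l// ler_pdivrMr// ler_pdivrMr//.
by rewrite [leRHS]mulrC.
Qed.

Lemma negbin_rate_continuous p a : 0 < p < 1 -> 0 < a ->
  {for a, continuous (negbin_rate p)}.
Proof.
move=> /andP[p0 p1] a0; have b0 : 0 < 1 + a by lra.
have q0 : 0 < 1 - p by lra.
have cvg_b : 1 + x @[x --> a] --> 1 + a.
  by apply: cvgD; [exact: cvg_cst|exact: cvg_id].
apply: cvgB.
  apply: cvgM; first exact: cvg_id.
  apply: continuous_cvg.
    by apply: continuous_ln; rewrite divr_gt0 ?mulr_gt0.
  apply: cvgM; first exact: cvg_id.
  apply: cvgV; first by rewrite gt_eqF// mulr_gt0.
  by apply: cvgM => //; exact: cvg_cst.
apply: continuous_cvg; first by apply: continuous_ln; rewrite mulr_gt0.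
by apply: cvgM => //; exact: cvg_cst.
Qed.

Lemma ln_le_subr1 x : 0 < x -> ln x <= x - 1.
Proof. by move=> x0; rewrite lerBrDl -[leRHS]lnK// expR_ge1Dx. Qed.

Lemma ln_lt_subr1 x : 0 < x -> x != 1 -> ln x < x - 1.
Proof.
move=> x0 x1; rewrite ltrBrDl -[ltRHS]lnK// expR_gt1Dx//.
by rewrite ln_eq0.
Qed.

Lemma subVr_le_ln x : 0 < x -> 1 - x^-1 <= ln x.
Proof.
move=> x0; have := ln_le_subr1 x^-1; rewrite invr_gt0 lnV// => /(_ x0); lra.
Qed.

(** Strict positivity of relative entropy, from ln x < x - 1 for x != 1. *)
Lemma negbin_rate_gt0 p a : 0 < p < 1 -> 0 < a -> a / (1 + a) != 1 - p ->
  0 < negbin_rate p a.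
Proof.
move=> p01 a0 neq; have /andP[p0 p1] := p01; have b0 : 0 < 1 + a by lra.
have q0 : 0 < 1 - p by lra.
have h1 : ln ((1 + a) * (1 - p) / a) < (1 + a) * (1 - p) / a - 1.
  apply: ln_lt_subr1; first by rewrite divr_gt0 ?mulr_gt0.
  apply: contra neq => /eqP e; apply/eqP.
  have E : (1 + a) * (1 - p) = a.
    by rewrite -[LHS](divfK (lt0r_neq0 a0)) e mul1r.
  by rewrite -{1}E mulrAC mulfV ?mul1r// gt_eqF.
have h2 : ln ((1 + a) * p) <= (1 + a) * p - 1 by rewrite ln_le_subr1// mulr_gt0.
rewrite /negbin_rate -[a / _]invf_div lnV ?posrE ?divr_gt0 ?mulr_gt0//.
have : a * ln ((1 + a) * (1 - p) / a) < (1 + a) * (1 - p) - a.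
  rewrite -(ltr_pM2l a0) in h1; apply: (lt_le_trans h1).
  by rewrite mulrBr mulr1 mulrC divfK ?gt_eqF.
nra.
Qed.

Lemma negbin_rate_geometric lambda mu : 0 < lambda -> 0 < mu ->
  negbin_rate (1 + mu)^-1 (lambda * mu) = geometric_rate lambda mu.
Proof.
move=> l0 m0; have b0 : 0 < 1 + mu by lra.
have lm0 : 0 < mu * lambda by rewrite mulr_gt0.
have c0 : 0 < 1 + mu * lambda by lra.
rewrite negbin_rateE; last 2 first.
- by rewrite invr_gt0 b0 invf_lt1//; lra.
- by rewrite mulr_gt0.
rewrite /geometric_rate (mulrC lambda).
have -> : 1 - (1 + mu)^-1 = mu / (1 + mu) by field; lra.
rewrite !ln_div ?posrE// lnV ?posrE// lnM ?posrE//; ring.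
Qed.

Lemma exponential_rate_gt0 (lambda : R) : 0 < lambda -> lambda != 1 ->
  0 < exponential_rate lambda.
Proof. by move=> l0 l1; rewrite subr_gt0 ln_lt_subr1. Qed.

Lemma ln_1BexpRN_bounds (lambda u h : R) : 0 < lambda -> 0 < u ->
  h = lambda * u ->
  ln lambda + ln u - h <= ln (1 - expR (- h)) <= ln lambda + ln u.
Proof.
move=> lambda_gt0 u_gt0 hE; have h_gt0 : 0 < h by rewrite hE mulr_gt0.
have p_gt0 : 0 < 1 - expR (- h) by rewrite subr_gt0 expR_lt1 oppr_lt0.
rewrite -lnM ?posrE// -hE; apply/andP; split.
  rewrite -[X in _ - X]expRK -ln_div ?posrE ?expR_gt0//.
  rewrite ler_ln ?posrE ?divr_gt0 ?expR_gt0// -expRN.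
  have := expR_ge1Dx h; rewrite -(ler_pM2r (expR_gt0 (- h))) -expRD subrr expR0.
  lra.
rewrite ler_ln ?posrE//; have := expR_ge1Dx (- h); lra.
Qed.

(** Here u is the mesh divided by the threshold lambda * mu, and h is the mesh
multiplied by the rate of the exponential law. Then the number of cells below
the threshold is 1 / u, and each logarithm in the rate is known up to O(u + h)
from 1 - 1 / x <= ln x <= x - 1. *)
Lemma negbin_rate_exponential (lambda u h p : R) : 0 < lambda -> 0 < u ->
  h = lambda * u -> p = 1 - expR (- h) ->
  exponential_rate lambda - (u + h) <= negbin_rate p u^-1
    <= exponential_rate lambda + (u + h).
Proof.
move=> lambda_gt0 u_gt0 hE pE.
have h_gt0 : 0 < h by rewrite hE mulr_gt0.
have p_01 : 0 < p < 1.
  by rewrite pE subr_gt0 expR_lt1 oppr_lt0 h_gt0 ltrBlDr ltrDl expR_gt0.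
have ln_q : ln (1 - p) = - h by rewrite pE opprB addrC subrK expRK.
have /andP[lnp1 lnp2] := ln_1BexpRN_bounds lambda u h lambda_gt0 u_gt0 hE.
rewrite -pE in lnp1 lnp2.
have u_neq0 : u != 0 by rewrite gt_eqF.
have v0 : 0 < u^-1 by rewrite invr_gt0.
rewrite negbin_rateE// ln_q.
have -> : 1 + u^-1 = (1 + u) / u by field; lra.
have w0 : 0 < 1 + u by lra.
rewrite ln_div ?posrE// lnV ?posrE//.
have lE : u^-1 * h = lambda by rewrite hE; field; lra.
have le_u : ln (1 + u) <= u by have := ln_le_subr1 _ w0; lra.
have ge_u : u / (1 + u) <= ln (1 + u).
  have -> : u / (1 + u) = 1 - (1 + u)^-1 by field; lra.
  exact: subVr_le_ln.
have le1 : u^-1 * ln (1 + u) <= 1.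
  by rewrite -[leRHS](mulVf u_neq0) ler_pM2l.
have ge1 : 1 - u <= u^-1 * ln (1 + u).
  rewrite -(ler_pM2l u_gt0) mulrA mulfV ?gt_eqF// mul1r.
  apply: le_trans ge_u; rewrite ler_pdivlMr//; nra.
have -> : u^-1 * (- ln u - (ln (1 + u) - ln u) - - h) =
   lambda - u^-1 * ln (1 + u) by rewrite -lE; ring.
have ln1_ge0 : 0 <= ln (1 + u) by rewrite ln_ge0//; lra.
rewrite /exponential_rate; apply/andP; split; lra.
Qed.

(** The same comparison for the threshold lowered by one cell. *)
Lemma negbin_rate_exponential_pred (lambda u h p : R) : 0 < lambda -> 0 < u ->
  h = lambda * u -> p = 1 - expR (- h) -> u < 1 ->
  exponential_rate lambda - (u + h) <= negbin_rate p (u^-1 - 1)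
    <= exponential_rate lambda + (u + h).
Proof.
move=> lambda_gt0 u_gt0 hE pE u1.
have h_gt0 : 0 < h by rewrite hE mulr_gt0.
have p_01 : 0 < p < 1.
  by rewrite pE subr_gt0 expR_lt1 oppr_lt0 h_gt0 ltrBlDr ltrDl expR_gt0.
have ln_q : ln (1 - p) = - h by rewrite pE opprB addrC subrK expRK.
have /andP[lnp1 lnp2] := ln_1BexpRN_bounds lambda u h lambda_gt0 u_gt0 hE.
rewrite -pE in lnp1 lnp2.
have u_neq0 : u != 0 by rewrite gt_eqF.
have v0 : 0 < u^-1 - 1 by rewrite subr_gt0 invf_gt1.
rewrite negbin_rateE// ln_q (addrC 1) subrK.
have w0 : 0 < 1 - u by lra.
have -> : u^-1 - 1 = (1 - u) / u by field; lra.
rewrite ln_div ?posrE// lnV ?posrE//.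
have le_u : ln (1 - u) <= - u by have := ln_le_subr1 _ w0; lra.
have ge_u : - u / (1 - u) <= ln (1 - u).
  have -> : - u / (1 - u) = 1 - (1 - u)^-1 by field; lra.
  exact: subVr_le_ln.
have c0 : 0 < (1 - u) / u by rewrite divr_gt0.
have le1 : (1 - u) / u * ln (1 - u) <= - (1 - u).
  suff -> : - (1 - u) = (1 - u) / u * (- u) by rewrite ler_pM2l.
  by field; lra.
have ge1 : - 1 <= (1 - u) / u * ln (1 - u).
  suff -> : - 1 = (1 - u) / u * (- u / (1 - u)) by rewrite ler_pM2l.
  by field; lra.
have -> : (1 - u) / u * (ln (1 - u) - ln u - - ln u - - h) =
   lambda - h + (1 - u) / u * ln (1 - u) by rewrite hE; field; lra.
rewrite /exponential_rate; apply/andP; split; lra.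
Qed.

End Rate.

(** * Series of extended reals *)

Lemma nneseries_le_bound {R : realType} (u : nat -> \bar R) (x : \bar R) :
  (forall k, 0 <= u k)%E -> (forall M, \sum_(m < M) u m <= x)%E ->
  (\sum_(0 <= m <oo) u m <= x)%E.
Proof.
move=> u0 ux; apply: lime_le; first exact: is_cvg_nneseries.
by apply: nearW => M; rewrite big_mkord.
Qed.

Lemma geometric_eseries {R : realType} (p : R) : 0 < p < 1 ->
  (\sum_(0 <= k <oo) (p * (1 - p) ^+ k)%:E = 1)%E.
Proof.
move=> /andP[p0 p1]; apply/cvg_lim => //=.
rewrite (_ : (fun n => _) = EFin \o series (geometric p (1 - p))); last first.
  by apply/funext => n /=; rewrite /series/= sumEFin.
apply: cvg_EFin; first exact: nearW.
have := @cvg_geometric_series R p (1 - p).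
by rewrite subKr divff ?gt_eqF//; apply; rewrite ger0_norm; lra.
Qed.

(** * Cells with geometric masses *)

Definition geometric_cells {d} {T : measurableType d} {R : realType}
    (P : probability T R) (p : R) (C : nat -> set R)
    (X : nat -> {RV P >-> R}) : Prop :=
  [/\ forall k, measurable (C k), trivIset setT C &
      forall i k, P (X i @^-1` C k) = (p * (1 - p) ^+ k)%:E].

Definition level {T : Type} {R : realType} (C : nat -> set R)
    (X : nat -> T -> R) (n m : nat) : set T :=
  [set w | exists k : nat -> nat,
     (forall i, (i <= n)%N -> C (k i) (X i w)) /\ (\sum_(i < n.+1) k i)%N = m].

Section Levels.
Context {d : measure_display} {T : measurableType d} {R : realType}.
Context {P : probability T R} {p : R} {C : nat -> set R}.
Context {X : nat -> {RV P >-> R}}.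
Hypotheses (indep : independent_RVs X) (cells : geometric_cells P p C X).

Lemma measurable_cell i k : measurable (X i @^-1` C k).
Proof.
have [mC _ _] := cells.
by rewrite -[_ @^-1` _]setTI; exact: measurable_funP.
Qed.

Lemma cell_inj w i k l : C k (X i w) -> C l (X i w) -> k = l.
Proof. by have [_ tC _] := cells => Ck Cl; apply: tC => //; exists (X i w). Qed.

(** The probability depends on the indices only through their sum, so that
computing the probability of a level reduces to counting. *)
Lemma cylinder_prob n (k : nat -> nat) :
  P (\bigcap_(i in `I_n) X i @^-1` C (k i)) =
  (p ^+ n * (1 - p) ^+ (\sum_(i < n) k i))%:E.
Proof.
have [mC _ massC] := cells.
pose J := [fset i in iota 0 n]%fset.
have JE : [set` J] = `I_n.
  by apply/seteqP; split => i /=; rewrite in_fset /= mem_iota add0n.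
rewrite -JE (indep J (fun i => C (k i))) //.
have perm_J : perm_eq J (iota 0 n).
  apply: uniq_perm; [exact: fset_uniq|exact: iota_uniq|].
  by move=> i; rewrite in_fset.
rewrite (perm_big _ perm_J)/=.
under eq_bigr do rewrite massC.
have -> : iota 0 n = index_iota 0 n by rewrite /index_iota subn0.
rewrite big_mkord.
elim: n {J JE perm_J} => [|n IH]; first by rewrite !big_ord0 !expr0 mulr1.
rewrite !big_ord_recr/= IH -EFinM exprD exprSr; congr (_%:E); ring.
Qed.

Definition compositions n m : {set n.+1.-tuple 'I_m.+1} :=
  [set t : n.+1.-tuple 'I_m.+1 | (\sum_(i <- t) i)%N == m]%SET.

Lemma level_bigcup n m : level C X n m =
  \bigcup_(t in [set` enum (compositions n m)])
    \bigcap_(i in `I_n.+1) X i @^-1` C (nth ord0 t i).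
Proof.
apply/seteqP; split => w.
  move=> [k [Ck sum_k]].
  have k_le (i : 'I_n.+1) : (k i < m.+1)%N.
    by rewrite ltnS -sum_k (bigD1 i)//= leq_addr.
  pose t : n.+1.-tuple 'I_m.+1 := [tuple Ordinal (k_le i) | i < n.+1].
  have tE (i : 'I_n.+1) : nth ord0 t i = k i :> nat.
    by rewrite -tnth_nth tnth_mktuple.
  exists t => /=.
    rewrite mem_enum inE; apply/eqP; rewrite -[RHS]sum_k big_tuple.
    by apply: eq_bigr => i _; rewrite tnth_mktuple.
  by move=> i /= lt_i; rewrite (tE (Ordinal lt_i)); apply: Ck; rewrite -ltnS.
move=> [t /=]; rewrite mem_enum inE => /eqP sum_t Ct.
exists (fun i => nth ord0 t i); split.
  by move=> i le_i; apply: Ct; rewrite /= ltnS.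
rewrite -[RHS]sum_t big_tuple; apply: eq_bigr => i _.
by rewrite (tnth_nth ord0).
Qed.

Lemma measurable_level n m : measurable (level C X n m).
Proof.
rewrite level_bigcup; apply: fin_bigcup_measurable; first exact: finite_seq.
move=> t _; apply: bigcap_measurable => [|i _]; first by exists 0%N.
  exact: measurable_cell.
Qed.

Lemma level_prob n m : P (level C X n m) =
  ('C(n + m, n)%:R * (p ^+ n.+1 * (1 - p) ^+ m))%:E.
Proof.
rewrite level_bigcup measure_fin_bigcup//; first last.
- move=> t _; apply: bigcap_measurable => [|i _]; first by exists 0%N.
  exact: measurable_cell.
- move=> s t _ _ [w [sw tw]]; apply/val_inj/(@eq_from_nth _ ord0).
    by rewrite !size_tuple.
  move=> i; rewrite size_tuple => lt_i; apply/val_inj.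
  by apply: (cell_inj w i); [exact: sw|exact: tw].
rewrite -fsbig_seq ?enum_uniq//.
rewrite (eq_big_seq (fun=> (p ^+ n.+1 * (1 - p) ^+ m)%:E)); last first.
  move=> t; rewrite mem_enum inE => /eqP sum_t.
  rewrite [LHS](cylinder_prob n.+1 (fun i => nth ord0 t i)).
  rewrite -[in RHS]sum_t big_tuple; congr (_ * _ ^+ _)%:E.
  by apply: eq_bigr => i _; rewrite (tnth_nth ord0).
rewrite sumEFin big_const_seq count_predT -cardE card_ord_partitions.
by rewrite iter_addr_0 mulr_natl.
Qed.

Lemma exists_level n w :
  (forall i, exists k, C k (X i w)) -> exists m, level C X n m w.
Proof.
move=> /choice[k Ck]; exists (\sum_(i < n.+1) k i)%N, k.
by split.
Qed.

Lemma cells_cover_ae i : 0 < p < 1 -> P (~` \bigcup_k X i @^-1` C k) = 0%E.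
Proof.
move=> p01; have [_ tC massC] := cells.
rewrite probability_setC; last first.
  by apply: bigcup_measurable => k _; exact: measurable_cell.
rewrite measure_semi_bigcup//; first last.
- by apply: bigcup_measurable => k _; exact: measurable_cell.
- by move=> k l _ _ [w [Ck Cl]]; exact: (cell_inj w i).
- by move=> k; exact: measurable_cell.
rewrite (eq_eseriesr (fun k _ => massC i k)).
by rewrite geometric_eseries// subee.
Qed.

(** Chernoff bound. Unless p = 1 / (1 + a), the hypothesis puts all levels that
meet A on one side of N a, the side on which tilting p to 1 / (1 + a) gives an
upper bound on their weights. *)
Lemma negbin_tail_le n (A : set T) a : 0 < p < 1 -> 0 < a -> measurable A ->
  (forall m w, level C X n m w -> A w ->
     0 <= (m%:R - n.+1%:R * a) * ln (a / ((1 + a) * (1 - p)))) ->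
  (P A <= (expR (- (n.+1%:R * negbin_rate p a)))%:E)%E.
Proof.
move=> p01 a0 mA tilt.
set D := expR _; pose U := \bigcup_m level C X n m.
pose N := \bigcup_i ~` \bigcup_k X i @^-1` C k.
have mU : measurable U.
  by apply: bigcup_measurable => m _; exact: measurable_level.
have mN i : measurable (~` \bigcup_k X i @^-1` C k).
  apply: measurableC; apply: bigcup_measurable => k _.
  exact: measurable_cell.
have mA_level m : measurable (A `&` level C X n m).
  by apply: measurableI => //; exact: measurable_level.
have /andP[r0 r1] : 0 <= a / (1 + a) <= 1.
  by rewrite divr_ge0 ?ler_pdivrMr; lra.
have AN0 : (P (A `\` U) <= 0)%E.
  apply: (@le_trans _ _ (\sum_(0 <= i <oo) P (~` \bigcup_k X i @^-1` C k)))%E.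
    apply: measure_sigma_subadditive => //; first exact: measurableD.
    move=> w [Aw nUw]; apply: contrapT => nNw; apply: nUw.
    have [|m lm] := exists_level n w; last by exists m.
    move=> i; apply: contrapT => nk; apply: nNw; exists i => // -[k _ Ck].
    by apply: nk; exists k.
  by rewrite eseries0// => i _ _; exact: cells_cover_ae.
have AU : (P (A `&` U) <= D%:E)%E.
  apply: (@le_trans _ _ (\sum_(0 <= m <oo) P (A `&` level C X n m)))%E.
    apply: measure_sigma_subadditive => //; first exact: measurableI.
    by rewrite /U setI_bigcupr.
  apply: nneseries_le_bound => [//|M].
  pose v m := D * ('C(n + m, n)%:R *
    ((1 - a / (1 + a)) ^+ n.+1 * (a / (1 + a)) ^+ m)).
  apply: (@le_trans _ _ (\sum_(m < M) (v m)%:E)%E).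
    apply: lee_sum => m _.
    have [->|/set0P[w [Aw lw]]] := eqVneq (A `&` level C X n m) set0.
      by rewrite measure0 lee_fin !mulr_ge0 ?expR_ge0 ?exprn_ge0 ?subr_ge0.
    apply: (@le_trans _ _ (P (level C X n m))).
      by apply: le_measure => //; apply: mem_set => //; exact: measurable_level.
    rewrite level_prob lee_fin /v [leRHS]mulrCA ler_wpM2l//.
    by apply: negbin_term_tilt => //; exact: tilt lw Aw.
  rewrite sumEFin lee_fin -mulr_sumr ler_piMr ?expR_ge0//.
  by apply: sum_negative_binomial_le1; rewrite r0.
rewrite (measureDI P mA mU) -[leRHS]add0e.
by apply: leeD.
Qed.

End Levels.

(** * Exponential scale *)

(** The index is shifted because the sample mean of zero variables is 0 by
convention. *)
Lemma cvg_neg_ln_div {R : realType} (u : nat -> R) (H : R) : 0 < H ->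
  (forall e, 0 < e -> \forall n \near \oo,
     expR (- (n.+1%:R * (H + e))) <= u n.+1 <= expR (- (n.+1%:R * (H - e)))) ->
  - ln (u n) / (n%:R * H) @[n --> \oo] --> (1 : R).
Proof.
move=> H0 bounds; rewrite -cvg_shiftS; apply/cvgrPdist_le => e e0 /=.
have eH0 : 0 < e * H by exact: mulr_gt0.
near=> n.
have N0 : 0 < n.+1%:R :> R by rewrite ltr0n.
have /andP[lo hi] : expR (- (n.+1%:R * (H + e * H))) <= u n.+1
    <= expR (- (n.+1%:R * (H - e * H))) by near: n; exact: bounds.
have u0 : 0 < u n.+1 by exact: lt_le_trans (expR_gt0 _) lo.
have lo' : - (n.+1%:R * (H + e * H)) <= ln (u n.+1).
  by rewrite -ler_expR lnK.
have hi' : ln (u n.+1) <= - (n.+1%:R * (H - e * H)).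
  by rewrite -ler_expR lnK.
have NH0 : 0 < n.+1%:R * H by exact: mulr_gt0.
have -> : 1 - - ln (u n.+1) / (n.+1%:R * H) =
    (n.+1%:R * H + ln (u n.+1)) / (n.+1%:R * H).
  by field; rewrite !gt_eqF//=; lra.
rewrite normrM [X in _ * X]gtr0_norm ?invr_gt0// ler_pdivrMr// ler_norml.
apply/andP; split; nra.
Unshelve. all: by end_near. Qed.

Lemma cvg_ratio_of_dist_le1 {R : realType} (m : nat -> nat) (a : R) :
  (forall n, `|(m n)%:R - n.+1%:R * a| <= 1) ->
  (m n)%:R / n.+1%:R @[n --> \oo] --> a.
Proof.
move=> dist; apply/cvgrPdist_le => e e0; near=> n.
have N0 : 0 < n.+1%:R :> R by rewrite ltr0n.
have -> : a - (m n)%:R / n.+1%:R = - ((m n)%:R - n.+1%:R * a) / n.+1%:R.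
  by field; rewrite gt_eqF//=; lra.
rewrite normrM normrN [X in _ * X]gtr0_norm ?invr_gt0//.
apply: (@le_trans _ _ (n.+1%:R^-1)); first by rewrite ler_piMl ?invr_ge0 ?ler0n.
near: n; have := @cvg_harmonic R => /cvgr_le; apply; exact: e0.
Unshelve. all: by end_near. Qed.

Lemma poly_le_expR_near {R : realType} (K e : R) : 0 < K -> 0 < e ->
  \forall n \near \oo, K * n.+1%:R <= expR (n.+1%:R * e).
Proof.
move=> K0 e0; near=> n.
have N0 : 0 < n.+1%:R :> R by rewrite ltr0n.
apply: le_trans (expR_ge1Dxn 1 _); last by rewrite mulr_ge0// ltW.
apply: (@le_trans _ _ ((n.+1%:R * e) ^+ 2 / 2)); last by rewrite lerDr ler01.
have -> : (n.+1%:R * e) ^+ 2 / 2 = (n.+1%:R * e ^+ 2 / 2) * n.+1%:R by field.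
rewrite ler_pM2r// ler_pdivlMr// -ler_pdivrMr ?exprn_gt0//.
apply: (@le_trans _ _ n%:R); last by rewrite ler_nat.
by near: n; exact: nbhs_infty_ger.
Unshelve. all: by end_near. Qed.

(** * Lower bound *)

Section Asymptotics.
Context {d : measure_display} {T : measurableType d} {R : realType}.
Context {P : probability T R} {p : R} {C : nat -> set R}.
Context {X : nat -> {RV P >-> R}}.
Hypotheses (indep : independent_RVs X) (cells : geometric_cells P p C X).

(** A single level inside A n is enough: the polynomial loss of [negbin_term_ge]
is absorbed by half of e, and the continuity of the rate uses the other
half. *)
Lemma negbin_tail_ge (A : nat -> set T) (m : nat -> nat) a e :
  0 < p < 1 -> 0 < a -> 0 < e -> (forall n, measurable (A n)) ->
  (forall n, `|(m n)%:R - n.+1%:R * a| <= 1) ->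
  (forall n, level C X n (m n) `<=` A n) ->
  \forall n \near \oo,
    ((expR (- (n.+1%:R * (negbin_rate p a + e))))%:E <= P (A n))%E.
Proof.
move=> p01 a0 e0 mA dist sub.
have m_cvg := cvg_ratio_of_dist_le1 m a dist.
have rate_cvg :
  negbin_rate p ((m n)%:R / n.+1%:R) @[n --> \oo] --> negbin_rate p a.
  by apply: continuous_cvg m_cvg; exact: negbin_rate_continuous.
(* (N + m) (N + m + 1) / N <= K N as soon as m <= N a + 1 and 1 <= N *)
pose K := (a + 2) * (a + 3).
near=> n.
have N0 : 0 < n.+1%:R :> R by rewrite ltr0n.
have N1 : 1 <= n.+1%:R :> R by rewrite ler1n.
have m0 : (0 < m n)%N.
  rewrite -(ltr0n R); have : 0 < (m n)%:R / n.+1%:R :> R.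
    by near: n; exact: cvgr_gt m_cvg _ _.
  by rewrite pmulr_lgt0// invr_gt0.
have rate_le : negbin_rate p ((m n)%:R / n.+1%:R) <= negbin_rate p a + e / 2.
  by near: n; apply: cvgr_le rate_cvg _ _; rewrite ltrDl divr_gt0.
have poly_le : K * n.+1%:R <= expR (n.+1%:R * (e / 2)).
  by near: n; apply: poly_le_expR_near; rewrite ?divr_gt0//; rewrite /K; nra.
apply: (@le_trans _ _ (P (level C X n (m n)))); last first.
  apply: le_measure; [apply: mem_set|apply: mem_set; exact: mA|exact: sub].
  exact: measurable_level cells _ _.
rewrite (level_prob indep cells) lee_fin.
apply: le_trans (negbin_term_ge _ _ _ p01 m0).
set N := n.+1%:R : R; set r := negbin_rate p _.
have -> : - (N * (negbin_rate p a + e)) =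
    - (N * (negbin_rate p a + e / 2)) - N * (e / 2) by field.
rewrite expRD ler_pM ?expR_ge0//.
  by rewrite ler_expR lerN2 ler_pM2l.
have M0 : 0 <= (m n)%:R :> R by exact: ler0n.
have M_le : (m n)%:R <= N * a + 1.
  by have /ler_normlP[_ h] := dist n; rewrite -/N in h; lra.
have -> : (n.+1 + m n).+1%:R = N + (m n)%:R + 1 by rewrite -natr1 natrD.
rewrite expRN natrD -/N.
have S0 : 0 < (N + (m n)%:R) * (N + (m n)%:R + 1) by apply: mulr_gt0; lra.
rewrite ler_pdivlMr// [leLHS]mulrC ler_pdivrMr ?expR_gt0//.
apply: (@le_trans _ _ (N * (K * N))); last by rewrite ler_pM2l.
have -> : N * (K * N) = (N * (a + 2)) * (N * (a + 3)) by rewrite /K; ring.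
by apply: ler_pM; lra.
Unshelve. all: by end_near. Qed.

End Asymptotics.

(** * Tails of the sample mean *)

Lemma measurable_sample_mean {d} {T : measurableType d} {R : realType}
    {P : probability T R} (X : nat -> {RV P >-> R}) n :
  measurable_fun setT (sample_mean X n).
Proof.
apply: measurable_funM; last exact: measurable_cst.
by apply: measurable_sum => i; exact: measurable_funP.
Qed.

Lemma measurable_upper_tail {d} {T : measurableType d} {R : realType}
    {P : probability T R} (X : nat -> {RV P >-> R}) n x :
  measurable [set w | x <= sample_mean X n w].
Proof.
rewrite [X in measurable X](_ : _ = setT `&` sample_mean X n @^-1` `[x, +oo[).
  exact: measurable_sample_mean.
by rewrite setTI; apply/seteqP; split => w /=; rewrite in_itv/= andbT.
Qed.

Lemma measurable_lower_tail {d} {T : measurableType d} {R : realType}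
    {P : probability T R} (X : nat -> {RV P >-> R}) n x :
  measurable [set w | sample_mean X n w <= x].
Proof.
rewrite [X in measurable X](_ : _ = setT `&` sample_mean X n @^-1` `]-oo, x]).
  exact: measurable_sample_mean.
by rewrite setTI; apply/seteqP; split => w /=; rewrite in_itv.
Qed.

(** From now on the cell of index k lies between c * k and c * k + e: a sample
mean is then known from the level up to e. An event on the sample mean at
threshold x contains, and is contained in, events on the sum of the indices at
thresholds x / c and (x - e) / c. *)
Section Mesh.
Context {d : measure_display} {T : measurableType d} {R : realType}.
Context {P : probability T R} {p : R} {C : nat -> set R}.
Context {X : nat -> {RV P >-> R}} {c e : R}.
Hypotheses (indep : independent_RVs X) (cells : geometric_cells P p C X).
Hypothesis mesh : forall k y, C k y -> c * k%:R <= y <= c * k%:R + e.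

Lemma level_sample_mean n m w : level C X n m w ->
  c * m%:R <= n.+1%:R * sample_mean X n.+1 w <= c * m%:R + n.+1%:R * e.
Proof.
move=> [k [Ck <-]]; rewrite /sample_mean [n.+1%:R * _]mulrC divfK ?pnatr_eq0//.
rewrite natr_sum mulr_sumr mulr_natl.
have -> : e *+ n.+1 = \sum_(i < n.+1) e by rewrite sumr_const card_ord.
rewrite -big_split/=.
by apply/andP; split; apply: ler_sum => i _;
  have /andP[] := mesh _ _ (Ck i (ltn_ord i)).
Qed.

Lemma upper_tail_bounds (x eps : R) :
  0 < p < 1 -> 0 < c -> 0 <= e -> e < x -> 0 < eps ->
  1 - p <= (x - e) / c * p ->
  \forall n \near \oo,
    expR (- (n.+1%:R * (negbin_rate p (x / c) + eps)))
    <= fine (P [set w | x <= sample_mean X n.+1 w])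
    <= expR (- (n.+1%:R * negbin_rate p ((x - e) / c))).
Proof.
move=> p01 c0 e0 ex eps0 mean_le.
have /andP[p0 p1] := p01; have q0 : 0 < 1 - p by lra.
have mA n := measurable_upper_tail X n.+1 x.
have x0 : 0 < x by lra.
have a0 : 0 < (x - e) / c by rewrite divr_gt0// subr_gt0.
have b0 : 0 < x / c by exact: divr_gt0.
pose m n := (Num.truncn (n.+1%:R * (x / c))).+1.
have m_itv n : (m n)%:R - 1 <= n.+1%:R * (x / c) < (m n)%:R.
  have /truncn_itv : 0 <= n.+1%:R * (x / c) by rewrite mulr_ge0// ltW.
  by rewrite /m -[X in X - 1]natr1 addrK.
have lower := negbin_tail_ge indep cells
  (fun n => [set w | x <= sample_mean X n.+1 w]) m (x / c) eps p01 b0 eps0 mA.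
have dist n : `|(m n)%:R - n.+1%:R * (x / c)| <= 1.
  by have /andP[h1 h2] := m_itv n; rewrite ler_norml; apply/andP; split; lra.
have sub n : level C X n (m n) `<=` [set w | x <= sample_mean X n.+1 w].
  move=> w /level_sample_mean /andP[h _] /=.
  have N0 : 0 < n.+1%:R :> R by rewrite ltr0n.
  rewrite -(ler_pM2l N0); apply: le_trans h.
  have /andP[_ /ltW] := m_itv n; rewrite mulrA ler_pdivrMr// => h.
  by rewrite [leRHS]mulrC.
have {lower dist sub} lower := lower dist sub.
near=> n.
rewrite -!lee_fin fineK ?fin_num_measure//; apply/andP; split.
  by near: n.
apply: (negbin_tail_le indep cells) => // k w.
move=> /level_sample_mean /andP[_ h] /= Aw.
have N0 : 0 < n.+1%:R :> R by rewrite ltr0n.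
apply: mulr_ge0.
  rewrite subr_ge0 mulrA ler_pdivrMr// mulrBr lerBlDr [_ * c]mulrC.
  by apply: le_trans h; rewrite ler_pM2l.
have b1 : 0 < 1 + (x - e) / c by lra.
rewrite ln_ge0// ler_pdivlMr ?mulr_gt0// mul1r.
by nra.
Unshelve. all: by end_near. Qed.

Lemma lower_tail_bounds (x eps : R) :
  0 < p < 1 -> 0 < c -> 0 <= e -> e < x -> 0 < eps ->
  x / c * p <= 1 - p ->
  \forall n \near \oo,
    expR (- (n.+1%:R * (negbin_rate p ((x - e) / c) + eps)))
    <= fine (P [set w | sample_mean X n.+1 w <= x])
    <= expR (- (n.+1%:R * negbin_rate p (x / c))).
Proof.
move=> p01 c0 e0 ex eps0 mean_ge.
have /andP[p0 p1] := p01; have q0 : 0 < 1 - p by lra.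
have mA n := measurable_lower_tail X n.+1 x.
have x0 : 0 < x by lra.
have a0 : 0 < (x - e) / c by rewrite divr_gt0// subr_gt0.
have b0 : 0 < x / c by exact: divr_gt0.
pose m n := Num.truncn (n.+1%:R * ((x - e) / c)).
have m_itv n : (m n)%:R <= n.+1%:R * ((x - e) / c) < (m n)%:R + 1.
  have /truncn_itv : 0 <= n.+1%:R * ((x - e) / c) by rewrite mulr_ge0// ltW.
  by rewrite natr1.
have lower := negbin_tail_ge indep cells
  (fun n => [set w | sample_mean X n.+1 w <= x]) m ((x - e) / c) eps
  p01 a0 eps0 mA.
have dist n : `|(m n)%:R - n.+1%:R * ((x - e) / c)| <= 1.
  by have /andP[h1 h2] := m_itv n; rewrite ler_norml; apply/andP; split; lra.
have sub n : level C X n (m n) `<=` [set w | sample_mean X n.+1 w <= x].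
  move=> w /level_sample_mean /andP[_ h] /=.
  have N0 : 0 < n.+1%:R :> R by rewrite ltr0n.
  rewrite -(ler_pM2l N0); apply: (le_trans h).
  have /andP[] := m_itv n; rewrite mulrA ler_pdivlMr// => h1 _.
  by rewrite -lerBrDr -mulrBr mulrC.
have {lower dist sub} lower := lower dist sub.
near=> n.
rewrite -!lee_fin fineK ?fin_num_measure//; apply/andP; split.
  by near: n.
apply: (negbin_tail_le indep cells) => // k w.
move=> /level_sample_mean /andP[h _] /= Aw.
have N0 : 0 < n.+1%:R :> R by rewrite ltr0n.
apply: mulr_le0.
  rewrite subr_le0 mulrA ler_pdivlMr// mulrC.
  by apply: (le_trans h); rewrite ler_pM2l.
have b1 : 0 < 1 + x / c by lra.
rewrite ln_le0// ler_pdivrMr ?mulr_gt0// mul1r.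
by nra.
Unshelve. all: by end_near. Qed.
End Mesh.

(** * The mean in terms of the cells *)

(** Shifting the index gives S = (1 - p) (S + 1) for the sum S of the series;
since S is finite, this equation determines it. *)
Lemma geometric_mean_eseries {R : realType} (p : R) : 0 < p < 1 ->
  (\sum_(0 <= k <oo) (k%:R * (p * (1 - p) ^+ k))%:E < +oo)%E ->
  (\sum_(0 <= k <oo) (k%:R * (p * (1 - p) ^+ k))%:E = ((1 - p) / p)%:E)%E.
Proof.
move=> p01 S_fin; have /andP[p0 p1] := p01.
have q0 : 0 <= 1 - p by lra.
set g := fun k => (p * (1 - p) ^+ k)%:E.
set f := fun k => (k%:R * (p * (1 - p) ^+ k))%:E.
rewrite -/f in S_fin *; set S := limn _ in S_fin *.
have g_ge0 k : (0 <= g k)%E by rewrite lee_fin mulr_ge0 ?exprn_ge0// ltW.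
have f_ge0 k : (0 <= f k)%E.
  by rewrite lee_fin mulr_ge0 ?mulr_ge0 ?exprn_ge0// ltW.
have S_ge0 : (0 <= S)%E.
  by rewrite /S; apply: nneseries_ge0 => k _ _; exact: f_ge0.
have SE : S = ((1 - p)%:E * (S + 1))%E.
  have recl : S = (\sum_(1 <= k <oo) f k)%E.
    rewrite /S nneseries_recl//; last by move=> k _; exact: f_ge0.
    by rewrite mulr0n mul0r add0e.
  rewrite {1}recl -(nneseries_addn 1 f_ge0).
  rewrite -(geometric_eseries _ p01) -nneseriesD; first last.
  - by move=> k _ _; exact: g_ge0.
  - by move=> k _ _; exact: f_ge0.
  rewrite -nneseriesZl; last by move=> k _; rewrite adde_ge0 ?f_ge0 ?g_ge0.
  apply: eq_eseriesr => k _; rewrite addn1 /f -EFinD -EFinM -natr1 exprS.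
  by congr (_%:E); ring.
have S_num : S \is a fin_num by rewrite ge0_fin_numE.
move: SE; rewrite -(fineK S_num) -EFinD -EFinM => -[sE]; congr (_%:E).
apply: (mulIf (lt0r_neq0 p0)); rewrite divfK ?gt_eqF//; lra.
Qed.

Section MeshMean.
Context {d : measure_display} {T : measurableType d} {R : realType}.
Context {P : probability T R} {p : R} {C : nat -> set R}.
Context {X : nat -> {RV P >-> R}} {c e : R}.
Hypotheses (cells : geometric_cells P p C X).
Hypothesis mesh : forall k y, C k y -> c * k%:R <= y <= c * k%:R + e.

Lemma expectation_cells i :
  0 < p < 1 -> 0 <= c ->
  ('E_P[X i] = \sum_(0 <= k <oo) \int[P]_(w in X i @^-1` C k) (X i w)%:E)%E.
Proof.
move=> p01 c0.
pose D := \bigcup_k X i @^-1` C k.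
have mD : measurable D.
  by apply: bigcup_measurable => k _; exact: measurable_cell cells _ _.
have mX D' : measurable_fun D' (EFin \o X i).
  by apply/measurable_EFinP; apply: measurable_funTS; exact: measurable_funP.
rewrite expectation_def -(ge0_integral_bigcup P)//; first last.
- by move=> k l _ _ [w [Ck Cl]]; exact: cell_inj cells w i k l Ck Cl.
- move=> w [k _ Ck]; rewrite lee_fin; have /andP[h _] := mesh _ _ Ck.
  by apply: le_trans h; rewrite mulr_ge0.
- by move=> k; exact: measurable_cell cells _ _.
rewrite [RHS]integral_mkcond; apply: ae_eq_integral => //.
- by apply/(measurable_restrictT _ mD); exact: (mX D).
exists (~` D); split.
- exact: measurableC.
- exact: (cells_cover_ae cells).
- move=> w /= nE Dw; apply: nE => _; rewrite patchE ifT//.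
  exact: mem_set.
Qed.

(** On the cell of index k the variable is between c * k and c * k + e, and the
index has mean (1 - p) / p. *)
Lemma mesh_mean_bounds i mu : 0 < p < 1 -> 0 < c -> 0 <= e ->
  ('E_P[X i] = mu%:E)%E -> c * ((1 - p) / p) <= mu <= c * ((1 - p) / p) + e.
Proof.
move=> p01 c0 e0; have /andP[p0 p1] := p01.
have q0 : 0 <= 1 - p by lra.
rewrite (expectation_cells _ p01 (ltW c0)) => mean.
have [_ _ massC] := cells.
have mE k : measurable (X i @^-1` C k) by exact: measurable_cell cells _ _.
have mX D' : measurable_fun D' (EFin \o X i).
  by apply/measurable_EFinP; apply: measurable_funTS; exact: measurable_funP.
pose g k := (p * (1 - p) ^+ k)%:E.
pose f k := (k%:R * (p * (1 - p) ^+ k))%:E.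
have g_ge0 k : (0 <= g k)%E by rewrite lee_fin mulr_ge0 ?exprn_ge0// ltW.
have f_ge0 k : (0 <= f k)%E.
  by rewrite lee_fin mulr_ge0 ?mulr_ge0 ?exprn_ge0// ltW.
have X_ge0 k w : C k (X i w) -> 0 <= X i w.
  by move=> /mesh /andP[h _]; apply: le_trans h; rewrite mulr_ge0// ltW.
have lo k : (c%:E * f k <= \int[P]_(w in X i @^-1` C k) (X i w)%:E)%E.
  have -> : (c%:E * f k = \int[P]_(w in X i @^-1` C k) (cst (c * k%:R)%:E w))%E.
    rewrite integral_cst// [X in _ = (_ * X)%E]massC /f -!EFinM.
    by congr (_%:E); ring.
  apply: ge0_le_integral => //.
  - by move=> w _; rewrite lee_fin mulr_ge0// ltW.
  - by move=> w /mesh /andP[h _]; rewrite lee_fin.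
have hi k : (\int[P]_(w in X i @^-1` C k) (X i w)%:E
    <= c%:E * f k + e%:E * g k)%E.
  have -> : (c%:E * f k + e%:E * g k =
      \int[P]_(w in X i @^-1` C k) (cst (c * k%:R + e)%:E w))%E.
    rewrite integral_cst// [X in _ = (_ * X)%E]massC /f /g -!EFinM -EFinD.
    by congr (_%:E); ring.
  apply: ge0_le_integral => //.
  - by move=> w /X_ge0; rewrite lee_fin.
  - by move=> w /mesh /andP[_ h]; rewrite lee_fin.
have I_ge0 k : (0 <= \int[P]_(w in X i @^-1` C k) (X i w)%:E)%E.
  by apply: le_trans (lo k); rewrite mule_ge0// lee_fin ltW.
have cf_ge0 k : (0 <= c%:E * f k)%E by rewrite mule_ge0// lee_fin ltW.
have cS_le : (c%:E * \sum_(0 <= k <oo) f k <= mu%:E)%E.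
  by rewrite -nneseriesZl// -mean; apply: lee_nneseries.
have S_fin : (\sum_(0 <= k <oo) f k < +oo)%E.
  rewrite ltey; apply/eqP => S_inf; move: cS_le.
  by rewrite S_inf gt0_muley ?lte_fin.
have SE := geometric_mean_eseries p p01 S_fin.
apply/andP; split; first by move: cS_le; rewrite SE -EFinM lee_fin.
rewrite -lee_fin -mean.
have -> : (c * ((1 - p) / p) + e)%:E =
    (c%:E * \sum_(0 <= k <oo) f k + e%:E * \sum_(0 <= k <oo) g k)%E.
  by rewrite SE geometric_eseries// -!EFinM -EFinD mulr1.
rewrite -!nneseriesZl// -nneseriesD//; first exact: lee_nneseries.
by move=> k _ _; rewrite mule_ge0.
Qed.

End MeshMean.


(** * Cells of the two laws *)

(** The first cell is [0, delta] and the cell of index k > 0 is the interval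
from delta * k to delta * (k + 1), closed on the right only. *)
Definition mesh_cell {R : realType} (delta : R) : nat -> set R :=
  seqD (fun k => `[0, delta * k.+1%:R]%classic).

Lemma exponential_cells {d} {T : measurableType d} {R : realType}
    {P : probability T R} (X : nat -> {RV P >-> R}) (rho delta : R) :
  0 < rho -> 0 < delta -> (forall i, exponential_RV rho (X i)) ->
  geometric_cells P (1 - expR (- (rho * delta)))
    (mesh_cell delta) X.
Proof.
move=> rho0 delta0 expX.
rewrite /mesh_cell; set F := fun k : nat => _.
have F_nd : nondecreasing_seq F.
  move=> k l kl; apply/subsetPset => y.
  rewrite /F/= !in_itv/= => /andP[-> h] /=.
  by apply: le_trans h _; rewrite ler_pM2l// ler_nat ltnS.
have mF k : measurable (F k) by exact: measurable_itv.
have PF i k : P (X i @^-1` F k) = (1 - expR (- (rho * delta)) ^+ k.+1)%:E.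
  have := expX i _ (mF k); rewrite exponential_prob_itv0c ?mulr_gt0//.
  rewrite /distribution /pushforward /= => ->.
  by rewrite EFinB mulNr mulrA -expRM_natl mulrN [_%:R * _]mulrC.
have mXF i k : measurable (X i @^-1` F k).
  by rewrite -[_ @^-1` _]setTI; exact: measurable_funP.
split.
- by move=> [|k] //=; rewrite /seqD; exact: measurableD.
- exact: trivIset_seqD.
move=> i [|k]; rewrite subKr /seqD.
  by rewrite PF expr1 expr0 mulr1.
have sub : X i @^-1` F k `<=` X i @^-1` F k.+1.
  by move=> w; exact: (subsetPset _ _ (F_nd _ _ (leqnSn k))).
transitivity (P (X i @^-1` F k.+1) - P (X i @^-1` F k))%E.
  transitivity (P ((X i @^-1` F k.+1) `\` (X i @^-1` F k))) => //.
  rewrite measureD//; last by rewrite -ge0_fin_numE ?fin_num_measure.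
  by rewrite setIidr.
rewrite !PF -EFinB; congr (_%:E); rewrite [in LHS]exprS; ring.
Qed.

Lemma exponential_cells_mesh {R : realType} (delta : R) (k : nat) (y : R) :
  0 < delta ->
  mesh_cell delta k y ->
  delta * k%:R <= y <= delta * k%:R + delta.
Proof.
move=> delta0; rewrite -[X in _ + X]mulr1 -mulrDr natr1.
case: k => [|k]; rewrite /mesh_cell /seqD /= !in_itv/=; first by rewrite mulr0.
by move=> [/andP[-> ->]] /negP; rewrite /= -ltNge andbT => /ltW.
Qed.

Lemma geometric_point_cells {d} {T : measurableType d} {R : realType}
    {P : probability T R} (X : nat -> {RV P >-> R}) (p : R) :
  (forall i, geometric_RV p (X i)) ->
  geometric_cells P p (fun k => [set k%:R]) X.
Proof.
move=> geoX; split => [k|k l _ _ [y [/= -> /eqP]]|i k].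
- exact: measurable_set1.
- by rewrite eqr_nat => /eqP.
- exact: geoX.
Qed.

(** * The two limits *)

Section MeanDeterminesParameter.
Context {d : measure_display} {T : measurableType d} {R : realType}.
Context {P : probability T R} (mu : R) (X : {RV P >-> R}).

Lemma geometric_with_mean_RV : geometric_with_mean mu X ->
  geometric_RV (1 + mu)^-1 X.
Proof.
move=> [p [p01 geoX mean]]; have /andP[p0 p1] := p01.
have cells := geometric_point_cells (fun=> X) p (fun=> geoX).
have mesh (k : nat) (y : R) : [set k%:R] y -> 1 * k%:R <= y <= 1 * k%:R + 0.
  by move=> ->; rewrite mul1r addr0 lexx.
have := mesh_mean_bounds cells mesh 0 mu p01 ltr01 (lexx 0) mean.
rewrite mul1r addr0 => /andP[le_mu ge_mu].
have muE : mu = (1 - p) / p by apply/le_anti; rewrite le_mu ge_mu.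
by have -> : (1 + mu)^-1 = p by rewrite muE; field; lra.
Qed.

(** The bounds of [mesh_mean_bounds] at mesh delta enclose mu, and they also
enclose 1 / rho because 1 + x <= exp x; hence mu and 1 / rho are within delta
of each other, for every delta. *)
Lemma exponential_with_mean_RV : 0 < mu -> exponential_with_mean mu X ->
  exponential_RV mu^-1 X.
Proof.
move=> mu0 [rho [rho0 expX mean]].
have close delta : 0 < delta -> `|mu - rho^-1| <= delta.
  move=> delta0.
  have cells := exponential_cells (fun=> X) rho delta rho0 delta0 (fun=> expX).
  have h0 : 0 < rho * delta by exact: mulr_gt0.
  set q := expR (- (rho * delta)) in cells.
  have q0 : 0 < q by exact: expR_gt0.
  have p0 : 0 < 1 - q by rewrite subr_gt0 expR_lt1 oppr_lt0.
  have p01 : 0 < 1 - q < 1 by rewrite p0 /=; lra.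
  have mesh := fun k y => @exponential_cells_mesh R delta k y delta0.
  have := mesh_mean_bounds cells mesh 0 mu p01 delta0 (ltW delta0) mean.
  rewrite subKr => /andP[le_mu ge_mu].
  have r0 : 0 < rho^-1 by rewrite invr_gt0.
  (* delta q / (1 - q) = delta / (exp (rho delta) - 1) *)
  have le_h : delta * (q / (1 - q)) <= rho^-1.
    rewrite mulrA ler_pdivrMr// -(ler_pM2l rho0) !mulrA mulfV ?gt_eqF// mul1r.
    have : (1 + rho * delta) * q <= expR (rho * delta) * q.
      by rewrite ler_pM2r// expR_ge1Dx.
    have -> : expR (rho * delta) * q = 1 by rewrite /q -expRD subrr expR0.
    lra.
  have ge_h : rho^-1 <= delta * (q / (1 - q)) + delta.
    have -> : delta * (q / (1 - q)) + delta = delta / (1 - q) by field; lra.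
    rewrite ler_pdivlMr// -(ler_pM2l rho0) mulrA mulfV ?gt_eqF// mul1r.
    by have := expR_ge1Dx (- (rho * delta)); rewrite -/q; lra.
  by rewrite ler_norml; apply/andP; split; lra.
have : mu - rho^-1 = 0.
  apply/eqP; rewrite -normr_eq0; apply: contraT => ne0.
  have : 0 < `|mu - rho^-1| by rewrite lt_neqAle eq_sym ne0 /=.
  move=> gt0; have := close (`|mu - rho^-1| / 2) (divr_gt0 gt0 (ltr0n _ 2)).
  lra.
by move=> /eqP; rewrite subr_eq0 => /eqP ->; rewrite invrK.
Qed.

End MeanDeterminesParameter.

Lemma geometric_tails {d} {T : measurableType d} {R : realType}
    {P : probability T R} (X : nat -> {RV P >-> R}) (lambda mu : R) :
  0 < lambda -> 0 < mu -> lambda != 1 ->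
  iid X -> (forall i, geometric_with_mean mu (X i)) ->
  (1 < lambda ->
      - ln (fine (P [set w | lambda * mu <= sample_mean X n w]))
        / (n%:R * geometric_rate lambda mu) @[n --> \oo] --> (1 : R)) /\
  (lambda < 1 ->
      - ln (fine (P [set w | sample_mean X n w <= lambda * mu]))
        / (n%:R * geometric_rate lambda mu) @[n --> \oo] --> (1 : R)).
Proof.
move=> l0 mu0 l1 [indep _] geoX.
pose p := (1 + mu)^-1.
have b0 : 0 < 1 + mu by lra.
have p01 : 0 < p < 1 by rewrite /p invr_gt0 b0 invf_lt1//; lra.
have pE : p * (1 + mu) = 1 by rewrite mulVf// gt_eqF.
have /andP[p0 p1] := p01.
have x0 : 0 < lambda * mu by exact: mulr_gt0.
have cells := geometric_point_cells X p
  (fun i => geometric_with_mean_RV _ _ (geoX i)).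
have mesh (k : nat) (y : R) : [set k%:R] y -> 1 * k%:R <= y <= 1 * k%:R + 0.
  by move=> ->; rewrite mul1r addr0 lexx.
have rateE := negbin_rate_geometric _ _ l0 mu0; rewrite -/p in rateE.
have rate_gt0 : 0 < geometric_rate lambda mu.
  rewrite -rateE; apply: negbin_rate_gt0 => //.
  apply: contra l1 => /eqP e; apply/eqP.
  have : lambda * mu = (1 - p) * (1 + lambda * mu).
    by rewrite -e divfK// gt_eqF//; lra.
  move=> lmuE; apply: (mulIf (lt0r_neq0 mu0)); apply: (mulIf (lt0r_neq0 p0)).
  nra.
split=> l_1; apply: cvg_neg_ln_div => // eps eps0.
- have le : 1 - p <= (lambda * mu - 0) / 1 * p.
    by rewrite subr0 divr1; nra.
  have := upper_tail_bounds indep cells mesh _ _ p01 ltr01 (lexx 0) x0 eps0 le.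
  rewrite subr0 divr1 rateE; apply: filterS => n /andP[-> h] /=.
  by apply: le_trans h _; rewrite ler_expR lerN2 ler_pM2l ?ltr0n//; lra.
- have le : lambda * mu / 1 * p <= 1 - p.
    by rewrite divr1; nra.
  have := lower_tail_bounds indep cells mesh _ _ p01 ltr01 (lexx 0) x0 eps0 le.
  rewrite subr0 divr1 rateE; apply: filterS => n /andP[-> h] /=.
  by apply: le_trans h _; rewrite ler_expR lerN2 ler_pM2l ?ltr0n//; lra.
Qed.

(** The mesh is delta = u * (lambda * mu). It has to be small enough for the
threshold to remain on the same side of the mean after a shift by delta, and
for the rates to be within eps / 2 of the exponential rate. *)
Lemma exponential_tails {d} {T : measurableType d} {R : realType}
    {P : probability T R} (Y : nat -> {RV P >-> R}) (lambda mu : R) :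
  0 < lambda -> 0 < mu -> lambda != 1 ->
  iid Y -> (forall i, exponential_with_mean mu (Y i)) ->
  (1 < lambda ->
      - ln (fine (P [set w | lambda * mu <= sample_mean Y n w]))
        / (n%:R * exponential_rate lambda) @[n --> \oo] --> (1 : R)) /\
  (lambda < 1 ->
      - ln (fine (P [set w | sample_mean Y n w <= lambda * mu]))
        / (n%:R * exponential_rate lambda) @[n --> \oo] --> (1 : R)).
Proof.
move=> l0 mu0 l1 [indep _] expY.
have rho0 : 0 < mu^-1 by rewrite invr_gt0.
have x0 : 0 < lambda * mu by exact: mulr_gt0.
have rate_gt0 := exponential_rate_gt0 _ l0 l1.
have RV i := exponential_with_mean_RV _ _ mu0 (expY i).
have [_ [_ _ mean]] := expY 0.
have mesh_exists eps : 0 < eps -> exists u : R,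
    [/\ 0 < u, u < 1, u * (lambda * mu) <= `|lambda - 1| * mu &
        u + lambda * u <= eps / 2].
  move=> eps0; have g0 : 0 < `|lambda - 1| by rewrite normr_gt0 subr_eq0.
  pose u := Num.min (2^-1)
    (Num.min (`|lambda - 1| / lambda) (eps / 2 / (1 + lambda))).
  exists u; have b0 : 0 < 1 + lambda by lra.
  split.
  - by rewrite !lt_min !divr_gt0// invr_gt0 ltr0n.
  - by rewrite gt_min invf_lt1 ?ltr1n.
  - by rewrite mulrA ler_pM2r// -ler_pdivlMr// /u !ge_min lexx orbT.
  - have -> : u + lambda * u = u * (1 + lambda) by ring.
    by rewrite -ler_pdivlMr// /u !ge_min lexx !orbT.
split=> l_1; apply: cvg_neg_ln_div => // eps eps0;
  have [u [u0 u1 gap err]] := mesh_exists eps eps0;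
  pose delta := u * (lambda * mu);
  have delta0 : 0 < delta by [exact: mulr_gt0];
  have delta_lt : delta < lambda * mu by [rewrite gtr_pMl];
  have cells := exponential_cells Y _ delta rho0 delta0 RV;
  set p := 1 - expR _ in cells;
  have hE : mu^-1 * delta = lambda * u by [rewrite /delta; field; lra];
  have h0 : 0 < mu^-1 * delta by [exact: mulr_gt0];
  have p01 : 0 < p < 1 by
    [rewrite /p subr_gt0 expR_lt1 oppr_lt0 h0 ltrBlDr ltrDl expR_gt0];
  have /andP[p0 p1] := p01;
  have mesh := (fun k y => @exponential_cells_mesh R delta k y delta0);
  have /andP[mu_ge mu_le] :=
    mesh_mean_bounds cells mesh 0 mu p01 delta0 (ltW delta0) mean;
  have a2E : lambda * mu / delta = u^-1 by
    [rewrite /delta; field; rewrite !gt_eqF];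
  have a1E : (lambda * mu - delta) / delta = u^-1 - 1 by
    [rewrite mulrBl a2E divff// gt_eqF];
  have /andP[r2_ge r2_le] := negbin_rate_exponential _ _ _ p l0 u0 hE erefl;
  have /andP[r1_ge r1_le] :=
    negbin_rate_exponential_pred _ _ _ p l0 u0 hE erefl u1;
  have eps20 : 0 < eps / 2 by [rewrite divr_gt0].
- have le : 1 - p <= (lambda * mu - delta) / delta * p.
    rewrite mulrAC ler_pdivlMr//.
    rewrite gtr0_norm ?subr_gt0// -/delta in gap.
    rewrite mulrA ler_pdivrMr// in mu_ge.
    nra.
  have := upper_tail_bounds indep cells mesh _ _
    p01 delta0 (ltW delta0) delta_lt eps20 le.
  rewrite a1E a2E; apply: filterS => n /andP[lo hi].
  have N0 : 0 < n.+1%:R :> R by rewrite ltr0n.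
  apply/andP; split.
    apply: le_trans lo; rewrite ler_expR lerN2 ler_pM2l//; lra.
  apply: (le_trans hi); rewrite ler_expR lerN2 ler_pM2l//; lra.
- have le : lambda * mu / delta * p <= 1 - p.
    rewrite mulrAC ler_pdivrMr//.
    rewrite ltr0_norm ?subr_lt0// -/delta in gap.
    have {}mu_le : (mu - delta) * p <= delta * (1 - p).
      by rewrite -ler_pdivlMr// -mulrA lerBlDr.
    nra.
  have := lower_tail_bounds indep cells mesh _ _
    p01 delta0 (ltW delta0) delta_lt eps20 le.
  rewrite a1E a2E; apply: filterS => n /andP[lo hi].
  have N0 : 0 < n.+1%:R :> R by rewrite ltr0n.
  apply/andP; split.
    apply: le_trans lo; rewrite ler_expR lerN2 ler_pM2l//; lra.
  apply: (le_trans hi); rewrite ler_expR lerN2 ler_pM2l//; lra.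
Qed.

Theorem corollary1 (R : realType) (lambda mu : R)
    (lambda_gt0 : 0 < lambda) (mu_gt0 : 0 < mu) (lambda_neq1 : lambda != 1) :
  (forall (d : measure_display) (T : measurableType d) (P : probability T R)
      (X : nat -> {RV P >-> R}),
    iid X -> (forall i, geometric_with_mean mu (X i)) ->
    (1 < lambda ->
      - ln (fine (P [set w | lambda * mu <= sample_mean X n w]))
        / (n%:R * geometric_rate lambda mu) @[n --> \oo] --> (1 : R)) /\
    (lambda < 1 ->
      - ln (fine (P [set w | sample_mean X n w <= lambda * mu]))
        / (n%:R * geometric_rate lambda mu) @[n --> \oo] --> (1 : R))) /\
  (forall (d : measure_display) (T : measurableType d) (P : probability T R)
      (Y : nat -> {RV P >-> R}),
    iid Y -> (forall i, exponential_with_mean mu (Y i)) ->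
    (1 < lambda ->
      - ln (fine (P [set w | lambda * mu <= sample_mean Y n w]))
        / (n%:R * exponential_rate lambda) @[n --> \oo] --> (1 : R)) /\
    (lambda < 1 ->
      - ln (fine (P [set w | sample_mean Y n w <= lambda * mu]))
        / (n%:R * exponential_rate lambda) @[n --> \oo] --> (1 : R))).
Proof.
split=> d T P X X_iid X_mean.
- exact: geometric_tails.
- exact: exponential_tails.
Qed.
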